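(* Let $n\ge 1$ and $k\ge 0$ be integers, let $\alpha\in[0,1)$, and let $G\in\mathcal{C}_n^k$ be a cactus with $n$ vertices and $k$ cycles. Let $C^c\in\mathcal{C}_n^k$ be the cactus consisting of $k$ triangles and $n-2k-1$ pendant edges all sharing one common vertex $v$. Then $$\rho(G)\le \rho(C^c),$$ where $\rho(\cdot)$ denotes the $A_\alpha$-spectral radius.
   Context: All graphs are finite and simple. For a graph $G$, let $A(G)$ be its adjacency matrix and $D(G)$ the diagonal matrix of vertex degrees. For $\alpha\in[0,1]$, $A_\alpha(G)=\alpha D(G)+(1-\alpha)A(G)$. The $A_\alpha$-spectral radius $\rho(G)$ is the largest eigenvalue of the real symmetric matrix $A_\alpha(G)$. A cactus is a connected graph such that any two of its cycles have at most one common vertex. $\mathcal{C}_n^k$ denotes the set of all cacti with $n$ vertices and $k$ cycles (if $\mathcal{C}_n^k$ is nonempty then $n\ge 2k+1$). $C^c$ denotes the cactus in $\mathcal{C}_n^k$ with vertices $v,v_1,\dots,v_k,v_1',\dots,v_k',u_1,\dots,u_{n-2k-1}$ whose edges are those of the $k$ triangles $vv_iv_i'v$ ($1\le i\le k$) together with the pendant edges $vu_1,\dots,vu_{n-2k-1}$. When $k=0$, $C^c$ is a star. *)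

(* Defs.v *)
From HB Require Import structures.
From mathcomp Require Import all_boot all_order all_algebra.
From mathcomp Require Import classical_sets reals.

Set Implicit Arguments.
Unset Strict Implicit.
Unset Printing Implicit Defensive.

Import Order.TTheory GRing.Theory Num.Theory.

Record graph (n : nat) := Graph {
  adj :> rel 'I_n;
  adj_sym : symmetric adj;
  adj_irr : irreflexive adj }.

Definition degree n (G : graph n) (x : 'I_n) : nat := #|[pred y | G x y]|.

Definition graph_connected n (G : graph n) : Prop := forall x y, connect G x y.

(* The edge set of the closed walk c_0 c_1 ... c_(m-1) c_0. *)
Definition cycle_edges n (c : seq 'I_n) : {set {set 'I_n}} :=
  [set [set x; next c x] | x in c].

(* Each cycle is represented by its edge set, so that the rotations and the
   reversal of a cyclic sequence count as one cycle; the vertex set of a cycle C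
   is then [finset.cover C]. *)
Definition cycles n (G : graph n) : {set {set {set 'I_n}}} :=
  \bigcup_(m < n.+1 | 2 < m)
    [set cycle_edges (tval t) | t : m.-tuple 'I_n & ucycleb G t].

Definition is_cactus n (G : graph n) : Prop :=
  graph_connected G /\
  (forall C1 C2 : {set {set 'I_n}}, C1 \in cycles G -> C2 \in cycles G ->
     C1 != C2 -> #|finset.cover C1 :&: finset.cover C2| <= 1).

Definition cactus_with n k (G : graph n) : Prop :=
  is_cactus G /\ #|cycles G| = k.

(* Vertex 0 is the common vertex v, the pair {v_i, v_i'} is {2i-1, 2i} for
   1 <= i <= k, and 2k+1, ..., n-1 are the pendant vertices. This is the intended
   graph only when 2k+1 <= n, which holds as soon as some cactus has n vertices
   and k cycles. *)
Definition bundle_adj (k i j : nat) : bool :=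
  (i != j) &&
  [|| i == 0, j == 0 |
      [&& i <= k.*2, j <= k.*2 & (i.-1)./2 == (j.-1)./2]].

Lemma bundle_adj_sym n k : symmetric (fun i j : 'I_n => bundle_adj k i j).
Proof.
move=> i j; rewrite /bundle_adj eq_sym orbCA [in RHS]andbCA.
by rewrite [((j : nat).-1)./2 == _]eq_sym.
Qed.

Lemma bundle_adj_irr n k : irreflexive (fun i j : 'I_n => bundle_adj k i j).
Proof. by move=> i; rewrite /bundle_adj eqxx. Qed.

Definition bundle n k : graph n :=
  Graph (@bundle_adj_sym n k) (@bundle_adj_irr n k).

Local Open Scope ring_scope.

Definition adj_mx (R : realType) n (G : graph n) : 'M[R]_n :=
  \matrix_(i, j) (G i j)%:R.

Definition degree_mx (R : realType) n (G : graph n) : 'M[R]_n :=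
  diag_mx (\row_i (degree G i)%:R).

Definition A_alpha (R : realType) n (al : R) (G : graph n) : 'M[R]_n :=
  al *: degree_mx R G + (1 - al) *: adj_mx R G.

(* A real symmetric matrix of positive size has a nonempty finite set of
   eigenvalues, so this supremum is their maximum. *)
Definition largest_eigenvalue (R : realType) n (A : 'M[R]_n) : R :=
  sup [set x : R | eigenvalue A x]%classic.

Definition rho (R : realType) n (al : R) (G : graph n) : R :=
  largest_eigenvalue (A_alpha al G).

(* Main.v *)
(* Let x be an eigenvector for rho(G), let y = |x| and let v be a vertex where y
   is largest. In the breadth-first tree of G rooted at v every edge outside the
   tree (a chord) avoids v, and the cycle it closes in the tree contains, with
   each end z of the chord, the parent of z. Two chords sharing the end z would
   thus close two cycles sharing an edge, so in a cactus the chords form a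
   matching, with at most k members. Since y is largest at v, attaching every
   vertex directly to v instead of to its parent does not decrease the quadratic
   form at y; the resulting star with a matching embeds into the bundle, and the
   Rayleigh principle concludes. *)

Require Import Defs.
From mathcomp Require Import classical_sets.
From mathcomp Require Import all_boot all_order all_algebra.
From mathcomp Require Import reals.
From mathcomp Require Import spectral zify ring.
From mathcomp.real_closed Require Import complex.

Set Implicit Arguments.
Unset Strict Implicit.
Unset Printing Implicit Defensive.

Import Order.TTheory GRing.Theory Num.Theory.

(** * Breadth-first trees and their chords *)

(** The clauses force [lev] to be the distance from [v]: the parents give a walk to [v] of [lev x]
    steps, and the last clause excludes shorter ones. *)
Definition bfs_tree n (G : graph n) (v : 'I_n) (lev : 'I_n -> nat)
    (par : 'I_n -> 'I_n) : Prop :=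
  [/\ lev v = 0,
      forall x, x != v -> G x (par x) /\ lev x = (lev (par x)).+1
    & forall x y, G x y -> lev y <= (lev x).+1].

(* [par v] is a junk value, whence the guards. *)
Definition tree_edge n (v : 'I_n) (par : 'I_n -> 'I_n) : rel 'I_n :=
  fun x y => (x != v) && (par x == y) || (y != v) && (par y == x).

Definition chord n (G : graph n) (v : 'I_n) (par : 'I_n -> 'I_n) : rel 'I_n :=
  fun x y => G x y && ~~ tree_edge v par x y.

(** Take for [par x] the last vertex but one of a shortest path from [v] to [x]. *)
Lemma bfs_tree_exists n (G : graph n) (v : 'I_n) :
  graph_connected G -> exists lev par, bfs_tree G v lev par.
Proof.
move=> connG.
have reach x : exists m,
    [exists t : m.-tuple 'I_n, path G v t && (last v t == x)].
  have /connectP[s sP ->] := connG v x.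
  by exists (size s); apply/existsP; exists (in_tuple s); rewrite /= sP eqxx.
pose lev x := ex_minn (reach x).
have lev_min s : path G v s -> lev (last v s) <= size s.
  move=> sP; rewrite /lev; case: ex_minnP => m _; apply.
  by apply/existsP; exists (in_tuple s); rewrite /= sP eqxx.
have levP x : exists s, [/\ path G v s, last v s = x & size s = lev x].
  rewrite /lev; case: ex_minnP => m /existsP[t /andP[tP /eqP tx]] _.
  by exists t; rewrite size_tuple.
have lev_step x y : G x y -> lev y <= (lev x).+1.
  move=> Gxy; have [s [sP sx <-]] := levP x.
  have := lev_min (rcons s y).
  by rewrite rcons_path last_rcons size_rcons sx Gxy sP; apply.
have /fin_all_exists[par parP] x : exists y,
    x != v -> G x y /\ lev x = (lev y).+1.
  have [s [sP sx s_size]] := levP x.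
  case/lastP: s => [|s z] in sP sx s_size *; first by exists v; rewrite -sx eqxx.
  rewrite rcons_path last_rcons size_rcons in sP sx s_size *.
  case/andP: sP => sP; rewrite sx => Gx; exists (last v s) => _.
  split; first by rewrite adj_sym.
  (* The truncated path bounds the level of the parent from above, the edge to [x] bounds it from
     below. *)
  by have := lev_min s sP; have := lev_step _ _ Gx; lia.
exists lev, par; split=> //.
by apply/eqP; rewrite -leqn0; have := lev_min [::] isT.
Qed.

Lemma tree_edge_sym n (v : 'I_n) par : symmetric (tree_edge v par).
Proof. by move=> x y; rewrite /tree_edge orbC. Qed.

Lemma chord_sym n (G : graph n) v par : symmetric (chord G v par).
Proof. by move=> x y; rewrite /chord adj_sym tree_edge_sym. Qed.

Lemma chord_neq n (G : graph n) v par x y : chord G v par x y -> x != y.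
Proof. by case/andP=> + _; apply: contraTneq => ->; rewrite adj_irr. Qed.

Lemma tree_edge_adj n (G : graph n) v lev par x y :
  bfs_tree G v lev par -> tree_edge v par x y -> G x y.
Proof.
case=> _ parP _ /orP[] /andP[/parP[Gpar _] /eqP eq_par].
  by rewrite -eq_par.
by rewrite adj_sym -eq_par.
Qed.

Lemma tree_connected n (G : graph n) v lev par x y :
  bfs_tree G v lev par -> connect (tree_edge v par) x y.
Proof.
move=> [_ parP _].
have symT : connect_sym (tree_edge v par).
  exact/sym_connect_sym/tree_edge_sym.
suff to_root z : connect (tree_edge v par) z v.
  by apply: connect_trans (to_root x) _; rewrite symT.
have [m] := ubnP (lev z); elim: m z => // m IHm z.
have [->|z_neq_v] := eqVneq z v; first by rewrite connect0.
have [_ ->] := parP _ z_neq_v => /IHm; apply: connect_trans.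
by apply: connect1; rewrite /tree_edge z_neq_v eqxx.
Qed.

(* After a step away from the root a simple tree path cannot turn back, because
   the only step towards the root would undo the previous one. *)
Lemma tree_path_descends n (G : graph n) v lev par x w s :
  bfs_tree G v lev par -> w != v -> par w = x ->
  path (tree_edge v par) w s -> uniq [:: x, w & s] ->
  lev (last w s) = (lev x + size s).+1.
Proof.
move=> bfs; have [_ parP _] := bfs.
elim: s x w => [|z s IHs] x w w_neq_v par_w /=.
  by move=> _ _; have [_ ->] := parP _ w_neq_v; rewrite par_w addn0.
case/andP=> wz zs /and3P[x_notin w_notin uniq_zs].
case/orP: wz => /andP[z_neq_v /eqP par_z].
  by rewrite -par_w par_z !inE eqxx orbT in x_notin.
rewrite (IHs w z) //=; last by rewrite w_notin.
by have [_ ->] := parP _ w_neq_v; rewrite par_w addnS addSn.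
Qed.

(** A neighbour of [v] has level 1, so its parent has level 0 and can only be [v]; hence every edge
    at [v] is a tree edge. *)
Lemma chord_neq_root n (G : graph n) v lev par x y :
  bfs_tree G v lev par -> chord G v par x y -> x != v.
Proof.
move=> [lev_v parP levG] /andP[Gxy]; apply: contraNneq => eq_xv.
have y_neq_v : y != v.
  by apply: contraTneq Gxy => ->; rewrite eq_xv adj_irr.
have [_ lev_y] := parP _ y_neq_v; have := levG _ _ Gxy.
rewrite eq_xv lev_v lev_y ltnS leqn0 => /eqP lev0.
have [eq_v|/parP[_]] := eqVneq (par y) v; last by rewrite lev0.
by rewrite /tree_edge y_neq_v eq_v eqxx orbT.
Qed.

(** A path that starts with a child of [x] descends at every step. The chord lets it end at most one
    level below [x], so it has a single step and the chord would be a tree edge. Hence the path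
    starts with [par x]. *)
Lemma chord_path_par n (G : graph n) v lev par x s :
  bfs_tree G v lev par -> chord G v par x (last x s) ->
  path (tree_edge v par) x s -> uniq (x :: s) -> par x \in s.
Proof.
move=> bfs; have [lev_v parP levG] := bfs.
case: s => [|w s] /=; first by rewrite /chord adj_irr.
case/andP=> Gxy not_tree /andP[xw ws] uniq_s.
case/orP: (xw) => /andP[w_neq_v /eqP par_w]; first by rewrite par_w mem_head.
have := tree_path_descends bfs w_neq_v par_w ws uniq_s.
have := levG _ _ Gxy => /[swap] ->; rewrite ltnS -{2}[lev x]addn0 leq_add2l.
by rewrite leqn0 => /nilP s_nil; rewrite s_nil /= xw in not_tree.
Qed.

(** * Cycles closed by chords *)

Lemma next_last (T : eqType) (x : T) s :
  uniq (x :: s) -> next (x :: s) (last x s) = x.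
Proof.
move=> uniq_s; rewrite next_nth mem_last index_last //.
by rewrite nth_default.
Qed.

Lemma mem_cycle_edges n (c : seq 'I_n) z :
  z \in c -> [set z; next c z] \in cycle_edges c.
Proof. exact: imset_f. Qed.

Lemma mem_cover_cycle_edges n (c : seq 'I_n) z :
  z \in c -> z \in finset.cover (cycle_edges c).
Proof.
by move=> /mem_cycle_edges zc; apply/bigcupP; exists [set z; next c z]; rewrite ?set21.
Qed.

Lemma set2_eqP (T : finType) (a b x y : T) :
  [set a; b] = [set x; y] -> a = x /\ b = y \/ a = y /\ b = x.
Proof.
move=> eqS.
have := set21 a b; rewrite eqS => /set2P[] eq_a;
have := set22 a b; rewrite eqS => /set2P[] eq_b; auto.
- have := set22 x y; rewrite -eqS => /set2P[] eq_y; subst; auto.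
- have := set21 x y; rewrite -eqS => /set2P[] eq_x; subst; auto.
Qed.

(** The cycle is the simple tree path from [x] to [y] closed by the chord. The path and its reversal
    yield the two parents, by [chord_path_par]. *)
Lemma fundamental_cycle n (G : graph n) v lev par x y :
  bfs_tree G v lev par -> chord G v par x y ->
  exists C, [/\ C \in cycles G, [set x; y] \in C,
    [set x; par x] \subset finset.cover C, [set y; par y] \subset finset.cover C
    & forall a b, chord G v par a b -> [set a; b] \in C ->
        [set a; b] = [set x; y]].
Proof.
move=> bfs xy; have /connectP[s0 s0P eq_y] := tree_connected x y bfs.
move: eq_y; case/shortenP: s0P => s sP uniq_s _ eq_y.
have xy' : chord G v par x (last x s) by rewrite -eq_y.
pose c := x :: s.
have Gyx : G y x by rewrite adj_sym; case/andP: xy.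
have y_c : y \in c by rewrite eq_y mem_last.
have next_y : next c y = x by rewrite eq_y next_last.
have cycle_c : ucycleb G c.
  rewrite /ucycleb uniq_s andbT /c /= rcons_path -eq_y Gyx andbT.
  by apply: sub_path sP => a b; apply: tree_edge_adj bfs.
have px_c : par x \in c.
  by rewrite inE (chord_path_par bfs xy' sP uniq_s) orbT.
have py_c : par y \in c.
  (* [rev (belast x s)] is the reversed path from [y] to [x] without its starting point. *)
  have : par y \in rev (belast x s).
    apply: (chord_path_par bfs).
    - rewrite chord_sym; suff -> : last y (rev (belast x s)) = x by [].
      case: (s) eq_y => [|w s'] /= eq_y; first by rewrite eq_y.
      by rewrite rev_cons last_rcons.
    - rewrite eq_y rev_path.
      by apply: sub_path sP => a b; rewrite tree_edge_sym.
    - by rewrite eq_y -rev_rcons -lastI rev_uniq.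
  by rewrite mem_rev => /mem_belast.
exists (cycle_edges c); split.
(* A path of at most one step would make the chord a loop or a tree edge. *)
- have size_c : 2 < size c.
    move: xy' sP; rewrite /chord /c.
    case: (s) => [|w [|]] //=; first by rewrite adj_irr.
    by case/andP=> _ /negPf->.
  have size_n : size c < n.+1.
    by rewrite ltnS -{2}[n]card_ord -(card_uniqP uniq_s) max_card.
  apply/bigcupP; exists (Ordinal size_n) => //.
  by apply/imsetP; exists (in_tuple c); rewrite ?inE.
- by rewrite setUC -{1}next_y mem_cycle_edges.
- by apply/subsetP=> z /set2P[] ->; apply: mem_cover_cycle_edges;
    rewrite ?mem_head.
- by apply/subsetP=> z /set2P[] ->; apply: mem_cover_cycle_edges.
move=> a b /andP[_ not_tree] /imsetP[z z_c eq_ab].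
(* Consecutive vertices of [c] satisfy [e]: the path consists of tree edges, and the closing step is
   the chord itself. *)
pose e : rel 'I_n := fun a b => tree_edge v par a b || ([set a; b] == [set x; y]).
have cycle_e : path.cycle e c.
  rewrite /= rcons_path -eq_y /e setUC eqxx orbT andbT.
  by apply: sub_path sP => i j; rewrite /e => ->.
have /orP[tree_z|/eqP <- //] := next_cycle cycle_e z_c.
by case: (set2_eqP eq_ab) => [] [eq_a eq_b];
  rewrite eq_a eq_b ?tree_z 1?tree_edge_sym ?tree_z in not_tree.
Qed.

(** The cycles closed by the two chords share [x] and [par x], so in a cactus they coincide, and
    such a cycle contains only one chord. *)
Lemma cactus_chord_unique n (G : graph n) v lev par x y z :
  is_cactus G -> bfs_tree G v lev par ->
  chord G v par x y -> chord G v par x z -> y = z.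
Proof.
move=> [_ cactG] bfs xy xz.
have [_ parP _] := bfs.
have x_neq : x != par x.
  have [+ _] := parP x (chord_neq_root bfs xy).
  by apply: contraTneq => <-; rewrite adj_irr.
have [C [C_cyc xyC xC _ C_uniq]] := fundamental_cycle bfs xy.
have [D [D_cyc xzD xD _ _]] := fundamental_cycle bfs xz.
have [eqCD|neqCD] := eqVneq C D.
  rewrite -eqCD in xzD.
  by case: (set2_eqP (C_uniq _ _ xz xzD)) => [[_ ->] | [-> ->]].
have := cactG _ _ C_cyc D_cyc neqCD.
rewrite leqNgt => /negP[].
have {x_neq} <- : #|[set x; par x]| = 2 by rewrite cards2 x_neq.
by rewrite subset_leq_card // subsetI xC.
Qed.

Lemma ltn_set2_inj n :
  {in [pred q : 'I_n * 'I_n | q.1 < q.2] &,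
    injective (fun q : 'I_n * 'I_n => [set q.1; q.2])}.
Proof.
move=> [a b] [c d]; rewrite !inE /= => ab cd /set2_eqP[] [] eq_a eq_b.
  by rewrite eq_a eq_b.
by rewrite eq_a eq_b ltnNge ltnW in ab.
Qed.

(* Each chord is recovered from the cycle it closes as the only chord there. *)
Lemma card_chords n (G : graph n) v lev par :
  bfs_tree G v lev par ->
  #|[set q : 'I_n * 'I_n | (q.1 < q.2) && chord G v par q.1 q.2]|
    <= #|cycles G|.
Proof.
move=> bfs; set P := [set q | _].
pose M := [set [set q.1; q.2] | q in P].
have <- : #|M| = #|P|.
  apply: card_in_imset => q r; rewrite !inE => /andP[lt_q _] /andP[lt_r _].
  exact: ltn_set2_inj.
(* It now suffices that every singleton of a chord in [M] is [C :&: M] for some cycle [C]. *)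
rewrite -(card_imset (mem M) set1_inj).
apply: leq_trans (leq_imset_card (fun C => C :&: M) (mem (cycles G))).
apply/subset_leq_card/subsetP => _ /imsetP[_ /imsetP[[x y] + ->] ->].
rewrite inE /= => /andP[lt_xy xy].
have [C [C_cyc xyC _ _ C_uniq]] := fundamental_cycle bfs xy.
apply/imsetP; exists C => //; apply/esym/setP => e.
rewrite !inE; apply/andP/eqP => [[eC /imsetP[[a b]]]|->].
  by rewrite inE /= => /andP[_ ab] eq_e; rewrite eq_e in eC *; apply: C_uniq.
by split=> //; apply/imsetP; exists (x, y); rewrite ?inE ?lt_xy.
Qed.

(** * Embedding a star with a matching into the bundle *)

Definition pair_flatten (T : Type) (s : seq (T * T)) : seq T :=
  flatten [seq [:: q.1; q.2] | q <- s].

Lemma mem_pair_flatten (T : eqType) (s : seq (T * T)) x :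
  reflect (exists2 q, q \in s & x = q.1 \/ x = q.2) (x \in pair_flatten s).
Proof.
apply: (iffP flatten_mapP) => -[q qs].
  by rewrite !inE => /orP[] /eqP ->; exists q; auto.
by case=> ->; exists q; rewrite ?inE ?eqxx ?orbT.
Qed.

Lemma uniq_pair_flatten (T : eqType) (s : seq (T * T)) :
  uniq s -> {in s, forall q, q.1 != q.2} ->
  {in s &, forall q r, q.1 \in [:: r.1; r.2] \/ q.2 \in [:: r.1; r.2] -> q = r} ->
  uniq (pair_flatten s).
Proof.
elim: s => [//|q s IHs] /= /andP[q_notin uniq_s] neq disj.
rewrite /pair_flatten /= -/(pair_flatten s) inE negb_or neq ?mem_head //=.
rewrite IHs // => [|r rs|r r' rs r's]; last 2 first.
- by apply: neq; rewrite inE rs orbT.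
- by apply: disj; rewrite inE ?rs ?r's orbT.
have notin z : z = q.1 \/ z = q.2 -> z \notin pair_flatten s.
  move=> zq; apply: contra q_notin => /mem_pair_flatten[r rs zr].
  rewrite (disj q r) ?mem_head ?inE ?rs ?orbT //.
  by case: zq => <-; [left | right]; case: zr => ->; rewrite eqxx ?orbT.
by rewrite !notin; auto.
Qed.

(** With the root put in front, these positions become [t.*2.+1] and [t.*2.+2], the labels of a
    triangle's two other vertices in [bundle]. *)
Lemma index_pair_flatten (T : eqType) (s : seq (T * T)) q :
  uniq (pair_flatten s) -> q \in s ->
  exists t, [/\ t < size s, index q.1 (pair_flatten s) = t.*2
               & index q.2 (pair_flatten s) = t.*2.+1].
Proof.
elim: s => [//|r s IHs] /=.
rewrite /pair_flatten /= -/(pair_flatten s) inE negb_or.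
case/and3P=> /andP[neq12 r1_notin] r2_notin uniq_s /predU1P[->|qs].
  by exists 0; rewrite !eqxx (negPf neq12).
have [t [lt_t i1 i2]] := IHs uniq_s qs.
have neq c d : c \in pair_flatten s -> d \notin pair_flatten s -> (d == c) = false.
  by move=> cs; apply: contraNF => /eqP ->.
have in1 : q.1 \in pair_flatten s by apply/mem_pair_flatten; exists q; auto.
have in2 : q.2 \in pair_flatten s by apply/mem_pair_flatten; exists q; auto.
by exists t.+1; rewrite !neq // i1 i2.
Qed.

(* The permutation lists the root, then the matched pairs, then the rest. *)
Lemma star_matching_embedding n k (v : 'I_n) (m : rel 'I_n) :
  symmetric m -> (forall x y, m x y -> x != v) ->
  (forall x y z, m x y -> m x z -> y = z) ->
  #|[set q : 'I_n * 'I_n | (q.1 < q.2) && m q.1 q.2]| <= k ->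
  exists2 f : 'I_n -> 'I_n, injective f &
    forall x y, x != y -> [|| x == v, y == v | m x y] -> bundle n k (f x) (f y).
Proof.
move=> m_sym m_root m_uniq; set P := [set q | _] => card_P.
have PP q : q \in enum P -> q.1 < q.2 /\ m q.1 q.2.
  by rewrite mem_enum inE => /andP[].
pose L := v :: pair_flatten (enum P).
have uniq_flat : uniq (pair_flatten (enum P)).
  apply: uniq_pair_flatten; first exact: enum_uniq.
    by move=> q /PP[lt_q _]; rewrite neq_ltn lt_q.
  move=> [a b] [c d].
  move=> /PP[/= lt_ab ab] /PP[/= lt_cd cd].
  rewrite !inE => share.
  have {share} : a = c \/ a = d \/ b = c \/ b = d.
    by case: share => /orP[] /eqP ->; auto.
  have ba : m b a by rewrite m_sym.
  have dc : m d c by rewrite m_sym.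
  (* Both pairs are increasing, so neither is the other one reversed. *)
  have absurd : a = d -> b = c -> (a, b) = (c, d).
    by move=> ad bc; rewrite ad bc ltnNge ltnW in lt_ab.
  case=> [eq|[eq|[eq|eq]]]; subst.
  - by rewrite (m_uniq _ _ _ ab cd).
  - by apply: absurd => //; apply: m_uniq ab dc.
  - by apply: absurd => //; apply: m_uniq ba cd.
  - by rewrite (m_uniq _ _ _ ba dc).
have uniq_L : uniq L.
  rewrite /= uniq_flat andbT; apply/mem_pair_flatten => -[q /PP[_ q12]].
  have q21 : m q.2 q.1 by rewrite m_sym.
  by case=> eq_v; [have := m_root _ _ q12 | have := m_root _ _ q21];
    rewrite -eq_v eqxx.
pose L' := L ++ [seq x <- enum 'I_n | x \notin L].
have L'_all x : x \in L'.
  by rewrite mem_cat mem_filter mem_enum andbT orbN.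
have uniq_L' : uniq L'.
  rewrite cat_uniq uniq_L filter_uniq ?enum_uniq // andbT /=.
  by apply/hasPn => x; rewrite mem_filter => /andP[].
have size_L' : size L' = n.
  rewrite -[RHS]card_ord -(card_uniqP uniq_L'); apply: eq_card => x.
  by rewrite L'_all.
have lt_index x : index x L' < n by rewrite -[X in _ < X]size_L' index_mem.
pose f x := Ordinal (lt_index x).
have f_inj : injective f.
  move=> x y /(congr1 val) eq_ind.
  by rewrite -[x](nth_index v (L'_all x)) [index x L']eq_ind nth_index.
exists f => // x y x_neq_y.
have f_v : f v = 0 :> nat by rewrite /= eqxx.
have f_pair q : q \in enum P ->
    exists t, [/\ t < k, f q.1 = t.*2.+1 :> nat & f q.2 = t.*2.+2 :> nat].
  move=> qP; have [t [lt_t i1 i2]] := index_pair_flatten uniq_flat qP.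
  have [_ q12] := PP _ qP.
  have in1 : q.1 \in pair_flatten (enum P).
    by apply/mem_pair_flatten; exists q; auto.
  have in2 : q.2 \in pair_flatten (enum P).
    by apply/mem_pair_flatten; exists q; auto.
  have neq1 : (v == q.1) = false.
    by apply/negbTE; rewrite eq_sym; apply: m_root q12.
  have neq2 : (v == q.2) = false.
    by apply/negbTE; rewrite eq_sym; apply: (m_root _ q.1); rewrite m_sym.
  exists t; split; first by rewrite (leq_trans lt_t) // -cardE.
    by rewrite /= neq1 index_cat in1 i1.
  by rewrite /= neq2 index_cat in2 i2.
rewrite -[bundle n k _ _]/(bundle_adj k (f x) (f y)) /bundle_adj.
rewrite (inj_eq val_inj) (inj_eq f_inj) x_neq_y andTb.
case/or3P=> [/eqP ->|/eqP ->|xy]; rewrite ?f_v ?eqxx ?orbT //.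
(* The labels [t.*2.+1] and [t.*2.+2] have the same [(_.-1)./2], namely [t], and are at most [k.*2]
   because [t < k]. *)
have := x_neq_y; rewrite neq_ltn => /orP[lt_xy|lt_yx].
  have [|t [lt_t /= -> /= ->]] := f_pair (x, y).
    by rewrite mem_enum inE lt_xy.
  lia.
have [|t [lt_t /= -> /= ->]] := f_pair (y, x).
  by rewrite mem_enum inE lt_yx m_sym.
lia.
Qed.

Local Open Scope ring_scope.

(** * The Rayleigh principle and the largest eigenvalue *)

(** Over the complex numbers [A] is Hermitian, hence unitarily diagonalizable with real spectrum;
    [a] is the largest diagonal entry. *)
Lemma rayleigh (R : rcfType) n (A : 'M[R]_n) : (0 < n)%N -> A^T = A ->
  exists2 a, eigenvalue A a &
    forall x : 'rV_n, (x *m A *m x^T) 0 0 <= a * (x *m x^T) 0 0.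
Proof.
move=> n_gt0 symA; pose i0 := Ordinal n_gt0.
pose toC := real_complex R; pose AC := map_mx toC A.
have conj_toC m p (B : 'M[R]_(m, p)) : map_mx Num.conj (map_mx toC B) = map_mx toC B.
  by apply/matrixP=> i j; rewrite !mxE; apply/CrealP/complex_realP; eexists.
have herm : AC \is hermsymmx.
  by apply/is_hermitianmxP; rewrite expr0 scale1r map_trmx symA conj_toC.
have /orthomx_spectralP := hermitian_normalmx herm.
have /mxOverP := hermitian_spectral_diag_real herm.
have := spectral_unitarymx AC.
move: (spectralmx AC) (spectral_diag AC) => P sp uniP real_sp eqA.
have unitP := unitarymx_unit uniP.
pose d j := complex.Re (sp 0 j).
have spE j : sp 0 j = toC (d j) by rewrite /d /toC RRe_real.
case: (@arg_maxP _ _ _ i0 predT d isT) => i _ max_i.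
exists (d i).
  (* Row [i] of [P] is a complex eigenvector; the eigenvalue descends to [R] as a root of the
     characteristic polynomial. *)
  rewrite eigenvalue_root_char -(fmorph_root toC) map_char_poly.
  rewrite -eigenvalue_root_char; apply/eigenvalueP; exists (row i P).
    rewrite -/AC eqA -row_mul !mulmxA mulmxV // mul1mx row_mul.
    by rewrite row_diag_mx -scalemxAl -rowE spE.
  apply: contraTneq (unitP) => Pi0; rewrite -row_free_unit; apply/row_freePn.
  by exists i; rewrite Pi0 sub0mx.
move=> x; rewrite -lecR -/toC.
(* [w] lists the coordinates of [x] in the spectral basis; both forms become weighted sums of their
   squared moduli. *)
pose y := map_mx toC x; pose w := y *m map_mx Num.conj P^T.
have wE : map_mx Num.conj w^T = P *m map_mx toC x^T.
  rewrite trmx_mul map_mxM map_trmx trmxK -map_mx_comp.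
  by rewrite (map_mx_id (@conjCK _)) -map_trmx conj_toC map_trmx.
have -> : toC ((x *m A *m x^T) 0 0) = \sum_j sp 0 j * (w 0 j * (w 0 j)^*).
  transitivity ((y *m AC *m map_mx toC x^T) 0 0).
    by rewrite /y -!map_mxM [RHS]mxE.
  rewrite eqA invmx_unitary // !mulmxA -mulmxA -wE -/w mul_mx_diag mxE.
  by apply: eq_bigr => j _; rewrite !mxE; rewrite mulrAC mulrC.
have -> : toC (d i * (x *m x^T) 0 0) = \sum_j sp 0 i * (w 0 j * (w 0 j)^*).
  rewrite (_ : toC _ = toC (d i) * toC ((x *m x^T) 0 0)); last exact: rmorphM.
  rewrite -spE -mulr_sumr; congr (_ * _).
  transitivity ((y *m map_mx toC x^T) 0 0).
    by rewrite /y -!map_mxM [RHS]mxE.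
  have -> : map_mx toC x^T = invmx P *m (P *m map_mx toC x^T).
    by rewrite mulmxA mulVmx // mul1mx.
  rewrite -wE invmx_unitary // mulmxA mxE.
  by apply: eq_bigr => j _; rewrite !mxE.
apply: ler_sum => j _; apply: ler_wpM2r; first exact: mul_conjC_ge0.
by rewrite !spE lecR; apply: max_i.
Qed.

Lemma row_dot_gt0 (R : realType) n (x : 'rV[R]_n) : x != 0 -> 0 < (x *m x^T) 0 0.
Proof.
move=> /rV0Pn[i xi].
have -> : (x *m x^T) 0 0 = \sum_j x 0 j ^+ 2.
  by rewrite mxE; apply: eq_bigr => j _; rewrite mxE expr2.
rewrite (bigD1 i) //= ltr_pwDl ?sumr_ge0 // => [|j _]; last exact: sqr_ge0.
by rewrite exprn_even_gt0.
Qed.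

(** The eigenvalue given by [rayleigh] bounds all others, as evaluation at their eigenvectors shows,
    so it is the supremum. *)
Lemma largest_eigenvalueP (R : realType) n (A : 'M[R]_n) : (0 < n)%N ->
  A^T = A -> eigenvalue A (largest_eigenvalue A) /\
    forall x : 'rV_n,
      (x *m A *m x^T) 0 0 <= largest_eigenvalue A * (x *m x^T) 0 0.
Proof.
move=> n_gt0 symA; have [a eig_a max_a] := rayleigh n_gt0 symA.
suff -> : largest_eigenvalue A = a by [].
have ubound_a : ubound [set x : R | eigenvalue A x]%classic a.
  move=> b /eigenvalueP[x xA x_neq0].
  by have := max_a x; rewrite xA -scalemxAl mxE ler_pM2r // row_dot_gt0.
apply/eqP; rewrite eq_le ge_sup //=; last by exists a.
by apply: ub_le_sup => //; exists a.
Qed.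

(** * The quadratic form as a sum over edges *)

(** This is what an edge whose ends carry [a] and [b] contributes to the quadratic form of
    [A_alpha]. *)
Definition edge_weight (R : realType) (al a b : R) : R :=
  al * (a ^+ 2 + b ^+ 2) + (1 - al) * (a * b) *+ 2.

(** Ordered pairs count each edge of a graph twice. Arbitrary relations are allowed, so that a tree
    can be given by its arrows from child to parent. *)
Definition edge_form (R : realType) n (al : R) (e : rel 'I_n)
    (y : 'I_n -> R) : R :=
  \sum_i \sum_j (e i j)%:R * edge_weight al (y i) (y j).

Lemma edge_weightC (R : realType) (al a b : R) :
  edge_weight al a b = edge_weight al b a.
Proof. by rewrite /edge_weight addrC [b ^+ 2 + _]addrC [b * a]mulrC addrC. Qed.

Lemma edge_weight_ge0 (R : realType) (al a b : R) :
  0 <= al -> al < 1 -> 0 <= a -> 0 <= b -> 0 <= edge_weight al a b.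
Proof.
move=> al_ge0 al_lt1 a_ge0 b_ge0.
have al'_ge0 : 0 <= 1 - al by rewrite subr_ge0 ltW.
by rewrite addr_ge0 ?mulr_ge0 ?addr_ge0 ?sqr_ge0 ?mulrn_wge0 ?mulr_ge0.
Qed.

Lemma edge_weight_le (R : realType) (al a b c : R) :
  0 <= al -> al < 1 -> 0 <= a -> 0 <= b -> b <= c ->
  edge_weight al a b <= edge_weight al a c.
Proof.
move=> al_ge0 al_lt1 a_ge0 b_ge0 b_le_c.
have al'_ge0 : 0 <= 1 - al by rewrite subr_ge0 ltW.
apply: lerD; last by rewrite lerMn2r ler_wpM2l ?ler_wpM2l ?orbT.
by rewrite ler_wpM2l // lerD2l lerXn2r // nnegrE ?(le_trans b_ge0).
Qed.

Lemma edge_weight_norm (R : realType) (al a b : R) : al < 1 ->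
  edge_weight al a b <= edge_weight al `|a| `|b|.
Proof.
move=> al_lt1; rewrite /edge_weight !real_normK ?num_real // lerD2l.
have al'_ge0 : 0 <= 1 - al by rewrite subr_ge0 ltW.
by rewrite -normrM lerMn2r ler_wpM2l ?ler_norm.
Qed.

Lemma A_alpha_edge_form (R : realType) n (al : R) (G : graph n) (x : 'rV_n) :
  (x *m A_alpha al G *m x^T) 0 0 *+ 2 = edge_form al G (x 0).
Proof.
have formE : (x *m A_alpha al G *m x^T) 0 0 =
    \sum_i \sum_j (G i j)%:R * (al * x 0 i ^+ 2 + (1 - al) * (x 0 i * x 0 j)).
  rewrite /A_alpha mulmxDr mulmxDl -!scalemxAr -!scalemxAl.
  rewrite [LHS]mxE [X in X + _]mxE [X in _ + X]mxE.
  have -> : (x *m degree_mx R G *m x^T) 0 0 =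
      \sum_i \sum_j (G i j)%:R * x 0 i ^+ 2.
    rewrite /degree_mx mul_mx_diag mxE; apply: eq_bigr => i _.
    rewrite !mxE -mulr_suml mulrAC -expr2 mulrC /degree -sum1_card natr_sum.
    congr (_ * _); rewrite big_mkcond; apply: eq_bigr => j _.
    by rewrite inE; case: (G i j).
  have -> : (x *m adj_mx R G *m x^T) 0 0 =
      \sum_i \sum_j (G i j)%:R * (x 0 i * x 0 j).
    rewrite mxE exchange_big; apply: eq_bigr => j _.
    rewrite mxE mulr_suml; apply: eq_bigr => i _.
    by rewrite !mxE; ring.
  rewrite !mulr_sumr -big_split; apply: eq_bigr => i _ /=.
  rewrite !mulr_sumr -big_split; apply: eq_bigr => j _ /=.
  by ring.
(* Adding the sum with exchanged indices completes the square of one end to the sum of both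
   squares. *)
rewrite mulr2n {2}formE exchange_big formE -big_split.
apply: eq_bigr => i _; rewrite -big_split; apply: eq_bigr => j _ /=.
by rewrite adj_sym /edge_weight; ring.
Qed.

Lemma edge_form_le_norm (R : realType) n (al : R) (e : rel 'I_n) y : al < 1 ->
  edge_form al e y <= edge_form al e (fun i => `|y i|).
Proof.
move=> al_lt1; apply: ler_sum => i _; apply: ler_sum => j _.
by rewrite ler_wpM2l ?edge_weight_norm.
Qed.

Lemma edge_form_le (R : realType) n (al : R) (e e' : rel 'I_n) y :
  0 <= al -> al < 1 -> (forall i, 0 <= y i) -> (forall i j, e i j -> e' i j) ->
  edge_form al e y <= edge_form al e' y.
Proof.
move=> al_ge0 al_lt1 y_ge0 sub_e; apply: ler_sum => i _; apply: ler_sum => j _.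
rewrite ler_wpM2r ?edge_weight_ge0 // ler_nat.
by case: (e i j) (sub_e i j) => // ->.
Qed.

Lemma edge_form_reindex (R : realType) n (al : R) (e : rel 'I_n) y
    (f g : 'I_n -> 'I_n) : cancel f g -> cancel g f ->
  edge_form al e (y \o g) = edge_form al (fun i j => e (f i) (f j)) y.
Proof.
move=> fK gK; have f_bij : {on predT, bijective f} by exists g => i _ /=.
rewrite /edge_form (reindex f) //; apply: eq_bigr => i _.
by rewrite (reindex f) //; apply: eq_bigr => j _; rewrite /= !fK.
Qed.

Lemma edge_form_flip (R : realType) n (al : R) (e : rel 'I_n) y :
  edge_form al (fun i j => e j i) y = edge_form al e y.
Proof.
rewrite /edge_form exchange_big; apply: eq_bigr => i _; apply: eq_bigr => j _.
by rewrite edge_weightC.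
Qed.

(** Each vertex other than [v] has one arrow. With [q] the parent map or the constant [v], this
    covers the tree before and after its edges are moved. *)
Lemma edge_form_pointer (R : realType) n (al : R) (v : 'I_n) q y :
  edge_form al (fun i j => (i != v) && (q i == j)) y =
  \sum_(i | i != v) edge_weight al (y i) (y (q i)).
Proof.
rewrite /edge_form [RHS]big_mkcond; apply: eq_bigr => i _.
case: (i != v); last by rewrite big1 // => j _; rewrite mul0r.
rewrite (bigD1 (q i)) //= eqxx mul1r big1 ?addr0 // => j j_neq.
by rewrite eq_sym (negPf j_neq) mul0r.
Qed.

(* Every tree edge is moved to the root, where [y] is largest. *)
Lemma edge_form_le_star (R : realType) n (al : R) (G : graph n) v lev par y :
  0 <= al -> al < 1 -> (forall i, 0 <= y i) -> (forall i, y i <= y v) ->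
  bfs_tree G v lev par ->
  edge_form al G y <= edge_form al
    (fun i j => (i != j) && [|| i == v, j == v | chord G v par i j]) y.
Proof.
move=> al_ge0 al_lt1 y_ge0 y_max bfs.
pose ptr q (i j : 'I_n) := (i != v) && (q i == j).
pose root := fun _ : 'I_n => v.
(* [three q] keeps the chords and attaches each other vertex [i] to [q i], counting both
   orientations. *)
pose three q := edge_form al (chord G v par) y + edge_form al (ptr q) y
  + edge_form al (fun i j => ptr q j i) y.
have threeE q : three q = \sum_i \sum_j
    (chord G v par i j + ptr q i j + ptr q j i)%:R * edge_weight al (y i) (y j).
  rewrite /three /edge_form -!big_split; apply: eq_bigr => i _ /=.
  by rewrite -!big_split; apply: eq_bigr => j _ /=; rewrite !natrD !mulrDl.
have ge0 i j := edge_weight_ge0 al_ge0 al_lt1 (y_ge0 i) (y_ge0 j).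
apply: (@le_trans _ _ (three par)).
  rewrite threeE; apply: ler_sum => i _; apply: ler_sum => j _.
  rewrite ler_wpM2r // ler_nat /chord /tree_edge /ptr.
  by case: (G i j); case: ((i != v) && _); case: ((j != v) && _).
apply: (@le_trans _ _ (three root)).
  rewrite /three (edge_form_flip al (ptr par)) (edge_form_flip al (ptr root)).
  rewrite !edge_form_pointer.
  have le_sums : \sum_(i | i != v) edge_weight al (y i) (y (par i)) <=
      \sum_(i | i != v) edge_weight al (y i) (y (root i)).
    by apply: ler_sum => i _; rewrite edge_weight_le.
  by rewrite !lerD.
(* With all arrows pointing to [v], the three indicators exclude one another, since chords avoid
   [v]; their sum is at most 1. *)
rewrite threeE; apply: ler_sum => i _; apply: ler_sum => j _.
rewrite ler_wpM2r // ler_nat /ptr /root ![v == _]eq_sym.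
case ij: (chord G v par i j).
  have ji : chord G v par j i by rewrite chord_sym.
  rewrite (negPf (chord_neq_root bfs ij)) (negPf (chord_neq_root bfs ji)).
  by rewrite (chord_neq ij).
have [->|i_neq_v] := eqVneq i v; first by case: eqVneq.
by have [->|] := eqVneq j v; rewrite ?i_neq_v.
Qed.

(** * Comparison of the spectral radii *)

Lemma A_alpha_sym (R : realType) n (al : R) (G : graph n) :
  (A_alpha al G)^T = A_alpha al G.
Proof.
rewrite /A_alpha linearD !linearZ /= /degree_mx tr_diag_mx; congr (_ + _ *: _).
by apply/matrixP=> i j; rewrite !mxE adj_sym.
Qed.

Theorem theorem6 (R : realType) (n k : nat) (al : R) (G : graph n)
  (n_ge1 : (1 <= n)%N) (al_ge0 : 0 <= al) (al_lt1 : al < 1)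
  (cactG : cactus_with k G) :
  rho al G <= rho al (bundle n k).
Proof.
have [/eigenvalueP[x xA x_neq0] _] :=
  largest_eigenvalueP n_ge1 (A_alpha_sym al G).
have [_ max_bundle] := largest_eigenvalueP n_ge1 (A_alpha_sym al (bundle n k)).
pose y i := `|x 0 i|.
have y_ge0 i : 0 <= y i by apply: normr_ge0.
case: (@arg_maxP _ _ _ (Ordinal n_ge1) predT y isT) => v _ y_max.
case: cactG => cactG card_cycles; have [connG _] := cactG.
have [lev [par bfs]] := bfs_tree_exists v connG.
have [|||f f_inj f_sub] :=
  @star_matching_embedding n k v (chord G v par) (@chord_sym _ _ _ _).
- by move=> a b; apply: chord_neq_root bfs.
- by move=> a b c; apply: cactus_chord_unique cactG bfs.
- by rewrite -card_cycles; apply: card_chords bfs.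
have [g fK gK] := injF_bij f_inj.
(* The vertex [f i] of the bundle receives the value [y i]. *)
pose z := \row_i y (g i).
have dot_z : (z *m z^T) 0 0 = (x *m x^T) 0 0.
  rewrite !mxE (reindex f); last by exists g => i _ /=.
  by apply: eq_bigr => i _; rewrite !mxE fK -!expr2 real_normK ?num_real.
(* Since [z] and [x] have the same norm, it suffices to compare the form of [G] at [x] with that of
   the bundle at [z]. *)
rewrite -(ler_pM2r (row_dot_gt0 x_neq0)) -{2}dot_z.
apply: le_trans (max_bundle z).
have -> : rho al G * (x *m x^T) 0 0 = (x *m A_alpha al G *m x^T) 0 0.
  by rewrite xA -scalemxAl [in RHS]mxE.
rewrite -(ler_pMn2r (ltn0Sn 1)) !A_alpha_edge_form.
apply: le_trans (edge_form_le_norm _ _ al_lt1) _.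
apply: le_trans (edge_form_le_star al_ge0 al_lt1 y_ge0 _ bfs) _.
  by move=> i; apply: y_max.
have -> : edge_form al (bundle n k) (z 0) = edge_form al (bundle n k) (y \o g).
  by apply: eq_bigr => i _; apply: eq_bigr => j _; rewrite !mxE.
rewrite (edge_form_reindex _ _ _ fK gK); apply: edge_form_le => // i j.
by case/andP; apply: f_sub.
Qed.
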